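(* Let $s\le d$ and $m$ be positive integers. Let $A$ be a real $m\times d$ matrix with $\|A\|_{op}=1$, and let $y=Ax^*+e$ for some $x^*\in\mathbb{R}^d$ and $e\in\mathbb{R}^m$. Let $0\le\eta\le1$ and let the sequences $(x^t)_{t\ge 0}$, $(a^t)_{t\ge1}$ be generated by Iterative Look Ahead Thresholding (with input $A,y,s$) with parameter $\eta$. Let $\tilde e=y-A(H_s(x^* ))$. If the restricted isometry constant $\delta_{2s}=\delta_{2s}(A)$ satisfies $$\delta_{2s}<\frac{1}{(2+2\eta)^2},$$ then for all $t\ge1$ $$\|H_s(x^* )-x^t\|_2\le\rho\,\|H_s(x^* )-x^{t-1}\|_2+(2+8\eta)\|\tilde e\|_2$$ with $\rho=(2+2\eta)\sqrt{\delta_{2s}}<1$.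
   Context: A vector is $s$-sparse if it has at most $s$ nonzero entries. $\|\cdot\|_{op}$ is the operator norm with respect to Euclidean norms; $A^*$ is the (conjugate) transpose. $H_s$ is the hard thresholding operator: $H_s(v)$ keeps the $s$ largest-magnitude entries of $v$ and sets the rest to zero (ties broken arbitrarily); it is a best $s$-term approximation of $v$. Thus $\tilde e=A(x^*-H_s(x^* ))+e$. Restricted isometry constant: $\delta_k(A)$ is the smallest $\delta\ge 0$ such that $(1-\delta)\|x\|_2^2\le\|Ax\|_2^2\le(1+\delta)\|x\|_2^2$ for every $k$-sparse $x$. Cost: $C(x)=\|y-Ax\|_2^2$, so $\nabla C(x)=-2A^*(y-Ax)$. Look ahead thresholding: for $\Omega\subset\{1,\dots,d\}$ let $P_\Omega$ be the coordinate projection onto the coordinates in $\Omega$ (other entries set to zero). For $z\in\mathbb{R}^d$ set $$f_{\eta,z}(x)=C(z)+\sum_{i=1}^d\left(2\eta\frac{\partial C}{\partial x_i}(z)(x_i-z_i)+(x_i-z_i)^2\right),$$ and let $H_{s,\eta}(z)$ be a minimizer of $f_{\eta,z}(P_\Omega z)$ over vectors $P_\Omega z$ with $|\Omega|=s$ (ties broken arbitrarily). Equivalently, $H_{s,\eta}(z)=P_\Omega z$ where $\Omega$ consists of the indices of the $s$ largest values of $-2\eta z_i\frac{\partial C}{\partial x_i}(z)+z_i^2$. Iterative Look Ahead Thresholding with parameter $\eta$: $x^0=0$ and, for $t\ge1$, $a^t=x^{t-1}+A^*(y-Ax^{t-1})$, $x^t=H_{s,\eta}(a^t)$. *)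

(* Defs.v *)
From mathcomp Require Import all_boot all_order all_algebra.
From mathcomp Require Import all_classical all_reals all_analysis.

Set Implicit Arguments.
Unset Strict Implicit.
Unset Printing Implicit Defensive.

Import Order.TTheory GRing.Theory Num.Theory.
Import numFieldNormedType.Exports.

Local Open Scope classical_set_scope.
Local Open Scope ring_scope.

(* The canonical norm on matrices in MathComp-Analysis is the max norm, hence
   an explicit Euclidean norm. *)
Definition l2norm (R : realType) (n : nat) (v : 'cV[R]_n) : R :=
  Num.sqrt (\sum_(i < n) v i 0 ^+ 2).

Definition op_norm (R : realType) (m d : nat) (A : 'M[R]_(m, d)) : R :=
  sup [set l2norm (A *m v) | v in [set v : 'cV[R]_d | l2norm v <= 1]].

Definition sparse (R : realType) (d k : nat) (v : 'cV[R]_d) : bool :=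
  (#|[pred i : 'I_d | v i 0%R != 0%R]| <= k)%N.

Definition RIP (R : realType) (m d k : nat) (A : 'M[R]_(m, d)) (delta : R) :
    Prop :=
  forall v : 'cV[R]_d, sparse k v ->
    (1 - delta) * l2norm v ^+ 2 <= l2norm (A *m v) ^+ 2 /\
    l2norm (A *m v) ^+ 2 <= (1 + delta) * l2norm v ^+ 2.

(* The infimum is attained: the set is nonempty, closed and bounded below. *)
Definition RIC (R : realType) (m d k : nat) (A : 'M[R]_(m, d)) : R :=
  inf [set delta : R | 0 <= delta /\ RIP k A delta].

Definition coord_proj (R : realType) (d : nat) (Omega : {set 'I_d})
    (v : 'cV[R]_d) : 'cV[R]_d :=
  \col_i (if i \in Omega then v i 0 else 0).

(* "w is a value of H_s(v)": a relation, because ties are broken arbitrarily. *)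
Definition is_hard_threshold (R : realType) (d s : nat) (v w : 'cV[R]_d) :
    Prop :=
  exists Omega : {set 'I_d},
    [/\ #|Omega| = s,
        forall i j, i \in Omega -> j \notin Omega -> `|v j 0| <= `|v i 0|
      & w = coord_proj Omega v].

Definition cost (R : realType) (m d : nat) (A : 'M[R]_(m, d)) (y : 'cV[R]_m)
    (x : 'cV[R]_d) : R :=
  l2norm (y - A *m x) ^+ 2.

Definition partial (R : realType) (d : nat) (f : 'cV[R]_d -> R) (i : 'I_d)
    (z : 'cV[R]_d) : R :=
  'D_(delta_mx i 0) f z.

Definition lookahead_obj (R : realType) (m d : nat) (A : 'M[R]_(m, d))
    (y : 'cV[R]_m) (eta : R) (z x : 'cV[R]_d) : R :=
  cost A y z +
  \sum_(i < d) (2 * eta * partial (cost A y) i z * (x i 0 - z i 0)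
                + (x i 0 - z i 0) ^+ 2).

(* "w is a value of H_{s,eta}(z)", again up to the choice among ties. *)
Definition is_lookahead_threshold (R : realType) (m d : nat)
    (A : 'M[R]_(m, d)) (y : 'cV[R]_m) (s : nat) (eta : R) (z w : 'cV[R]_d) :
    Prop :=
  exists Omega : {set 'I_d},
    [/\ #|Omega| = s,
        forall Omega' : {set 'I_d}, #|Omega'| = s ->
          lookahead_obj A y eta z (coord_proj Omega z)
            <= lookahead_obj A y eta z (coord_proj Omega' z)
      & w = coord_proj Omega z].

(* The value [a 0] is irrelevant: the sequence a starts at index 1. *)
Definition is_ILAT (R : realType) (m d : nat) (A : 'M[R]_(m, d))
    (y : 'cV[R]_m) (s : nat) (eta : R) (x a : nat -> 'cV[R]_d) : Prop :=
  x 0%N = 0 /\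
  forall t : nat, (1 <= t)%N ->
    a t = x t.-1 + A^T *m (y - A *m x t.-1) /\
    is_lookahead_threshold A y s eta (a t) (x t).

(* Main.v *)
(* Write [h] for the hard thresholding of [xstar], [v = h - x^{t-1}],
   [G = A^T A] and [b = A^T (y - A a^t)].
   Then [a^t - h = A^T etilde - (1 - G) v] and
   [b = (1 - G) A^T etilde + G (1 - G) v].  Since [0 <= G <= 1], both
   [(1 - G)^2] and [4 (G (1 - G))^2] are dominated by [1 - G], and
   [<v, (1 - G) v> = |v|^2 - |A v|^2 <= delta_2s |v|^2]; hence
   [|a^t - h| <= sqrt delta_2s |v| + |etilde|] and
   [|b| <= sqrt delta_2s |v| / 2 + |etilde|].
   The look-ahead objective at [x] is, up to a constant,
   [|x - a^t|^2 - 4 eta <x - a^t, b>], so comparing its minimizer with the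
   projection of [a^t] on the support of [h] yields
   [|x^t - a^t| <= |a^t - h| + 4 eta |b|], and the triangle inequality
   concludes, with [2 + 4 eta] in front of [|etilde|]. *)

Require Import Defs.
From mathcomp Require Import all_boot all_order all_algebra.
From mathcomp Require Import all_classical all_reals all_analysis.
From mathcomp Require Import ring lra.

Import Order.TTheory GRing.Theory Num.Theory.
Import numFieldNormedType.Exports.

Local Open Scope ring_scope.

(** * Euclidean inner product and norm *)

Definition dot {R : realType} {n : nat} (u v : 'cV[R]_n) : R :=
  \sum_(i < n) u i 0 * v i 0.

Lemma dotC {R : realType} {n : nat} (u v : 'cV[R]_n) : dot u v = dot v u.
Proof. by apply: eq_bigr => i _; rewrite mulrC. Qed.

Lemma dotDl {R : realType} {n : nat} (u v w : 'cV[R]_n) :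
  dot (u + v) w = dot u w + dot v w.
Proof. by rewrite -big_split; apply: eq_bigr => i _; rewrite mxE mulrDl. Qed.

Lemma dotZl {R : realType} {n : nat} (c : R) (u w : 'cV[R]_n) :
  dot (c *: u) w = c * dot u w.
Proof. by rewrite mulr_sumr; apply: eq_bigr => i _; rewrite mxE mulrA. Qed.

Lemma dotNl {R : realType} {n : nat} (u w : 'cV[R]_n) :
  dot (- u) w = - dot u w.
Proof. by rewrite -scaleN1r dotZl mulN1r. Qed.

Lemma dotDr {R : realType} {n : nat} (u v w : 'cV[R]_n) :
  dot w (u + v) = dot w u + dot w v.
Proof. by rewrite dotC dotDl !(dotC w). Qed.

Lemma dotZr {R : realType} {n : nat} (c : R) (u w : 'cV[R]_n) :
  dot w (c *: u) = c * dot w u.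
Proof. by rewrite dotC dotZl dotC. Qed.

Lemma dotNr {R : realType} {n : nat} (u w : 'cV[R]_n) :
  dot w (- u) = - dot w u.
Proof. by rewrite dotC dotNl dotC. Qed.

Definition dotE := (@dotDl, @dotDr, @dotNl, @dotNr, @dotZl, @dotZr).

Lemma dotB_sqr {R : realType} {n : nat} (u v : 'cV[R]_n) :
  dot (u - v) (u - v) = dot u u - 2 * dot u v + dot v v.
Proof. by rewrite !dotE (dotC v u); ring. Qed.

Lemma dot_ge0 {R : realType} {n : nat} (u : 'cV[R]_n) : 0 <= dot u u.
Proof. by apply: sumr_ge0 => i _; rewrite -expr2 sqr_ge0. Qed.

Lemma dot_trmx {R : realType} {m n : nat} (A : 'M[R]_(m, n)) u w :
  dot (A *m u) w = dot u (A^T *m w).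
Proof.
have dot_mx k (p q : 'cV[R]_k) : dot p q = (p^T *m q) 0 0.
  by rewrite mxE; apply: eq_bigr => i _; rewrite mxE.
by rewrite !dot_mx trmx_mul mulmxA.
Qed.

Lemma l2norm_ge0 {R : realType} {n : nat} (u : 'cV[R]_n) : 0 <= l2norm u.
Proof. exact: sqrtr_ge0. Qed.

Lemma l2norm_sqr {R : realType} {n : nat} (u : 'cV[R]_n) :
  l2norm u ^+ 2 = dot u u.
Proof.
rewrite sqr_sqrtr; first by apply: eq_bigr => i _; rewrite expr2.
by apply: sumr_ge0 => i _; rewrite sqr_ge0.
Qed.

Lemma l2norm_eq0 {R : realType} {n : nat} (u : 'cV[R]_n) :
  l2norm u = 0 -> u = 0.
Proof.
move=> /(congr1 (fun c => c ^+ 2)); rewrite expr0n /= l2norm_sqr => /eqP.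
rewrite psumr_eq0 => [/allP u0|i _]; last by rewrite -expr2 sqr_ge0.
apply/matrixP => i j; rewrite ord1 mxE; apply/eqP.
by have := u0 i (mem_index_enum i); rewrite mulf_eq0 orbb.
Qed.

Lemma l2normZ {R : realType} {n : nat} (c : R) (u : 'cV[R]_n) :
  l2norm (c *: u) = `|c| * l2norm u.
Proof.
apply: (@pexpIrn _ 2) => //; rewrite ?nnegrE ?mulr_ge0 ?l2norm_ge0 //.
by rewrite exprMn !l2norm_sqr !dotE real_normK ?num_real // mulrA.
Qed.

Lemma l2normN {R : realType} {n : nat} (u : 'cV[R]_n) :
  l2norm (- u) = l2norm u.
Proof. by rewrite -scaleN1r l2normZ normrN1 mul1r. Qed.

Lemma l2norm_le {R : realType} {n : nat} (u : 'cV[R]_n) (c : R) :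
  0 <= c -> dot u u <= c ^+ 2 -> l2norm u <= c.
Proof. by move=> c0; rewrite -l2norm_sqr ler_pXn2r // nnegrE l2norm_ge0. Qed.

(** Cauchy-Schwarz: expand the squared norm of [|v| u - |u| v], which equals
    [2 |u| |v| (|u| |v| - <u, v>)], and cancel the factor when both norms are nonzero. *)
Lemma dot_le_l2norm {R : realType} {n : nat} (u v : 'cV[R]_n) :
  dot u v <= l2norm u * l2norm v.
Proof.
have := dot_ge0 (l2norm v *: u - l2norm u *: v).
rewrite !dotE -!l2norm_sqr (dotC v u).
have [/l2norm_eq0 ->|u0] := eqVneq (l2norm u) 0.
  by rewrite -(scale0r v) dotZl l2normZ normr0 !mul0r.
have [/l2norm_eq0 ->|v0] := eqVneq (l2norm v) 0.
  by rewrite -(scale0r u) dotZr l2normZ normr0 !mul0r mulr0.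
have ugt0 : 0 < l2norm u by rewrite lt0r u0 l2norm_ge0.
have vgt0 : 0 < l2norm v by rewrite lt0r v0 l2norm_ge0.
move=> H; rewrite -(ler_pM2l (mulr_gt0 ugt0 vgt0)); lra.
Qed.

Lemma ler_l2normD {R : realType} {n : nat} (u v : 'cV[R]_n) :
  l2norm (u + v) <= l2norm u + l2norm v.
Proof.
apply: l2norm_le; first by rewrite addr_ge0 ?l2norm_ge0.
by rewrite !dotE -!l2norm_sqr (dotC v u); have := dot_le_l2norm u v; lra.
Qed.

Lemma ler_l2normB {R : realType} {n : nat} (u v : 'cV[R]_n) :
  l2norm (u - v) <= l2norm u + l2norm v.
Proof. by rewrite -(l2normN v) ler_l2normD. Qed.

(** * Contractions and the restricted isometry constant *)

Lemma op_norm1_contraction {R : realType} {m d : nat} (A : 'M[R]_(m, d)) :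
  op_norm A = 1 -> forall v, l2norm (A *m v) <= l2norm v.
Proof.
rewrite /op_norm; set E := (X in sup X) => A1 v.
(* [sup] is [0] on sets without a supremum *)
have supE : has_sup E.
  apply: contrapT => /sup_out E0.
  by move: A1; rewrite E0 => /esym/eqP; rewrite oner_eq0.
have [v0|v0] := eqVneq (l2norm v) 0.
  rewrite (l2norm_eq0 _ v0) mulmx0 -(scale0r (0 : 'cV_m)) l2normZ normr0 mul0r.
  exact: l2norm_ge0.
have vgt0 : 0 < l2norm v by rewrite lt0r v0 l2norm_ge0.
have : l2norm (A *m ((l2norm v)^-1 *: v)) <= 1.
  rewrite -A1; apply: sup_upper_bound => //=; exists ((l2norm v)^-1 *: v) => //=.
  by rewrite l2normZ ger0_norm ?invr_ge0 ?l2norm_ge0 // mulVf.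
rewrite -scalemxAr l2normZ ger0_norm ?invr_ge0 ?l2norm_ge0 //.
by rewrite ler_pdivrMl // mulr1.
Qed.

(** [|A^T w|^2 = <A A^T w, w> <= |A^T w| |w|]; cancel [|A^T w|]. *)
Lemma trmx_contraction {R : realType} {m d : nat} (A : 'M[R]_(m, d)) :
  (forall v, l2norm (A *m v) <= l2norm v) ->
  forall w, l2norm (A^T *m w) <= l2norm w.
Proof.
move=> Ale w; have [->|Aw0] := eqVneq (l2norm (A^T *m w)) 0.
  exact: l2norm_ge0.
have Aw_gt0 : 0 < l2norm (A^T *m w) by rewrite lt0r Aw0 l2norm_ge0.
rewrite -(ler_pM2l Aw_gt0) -expr2 l2norm_sqr -dot_trmx.
apply: (le_trans (dot_le_l2norm _ _)).
by rewrite ler_wpM2r ?l2norm_ge0.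
Qed.

Lemma RIC_ge0 {R : realType} {m d : nat} k (A : 'M[R]_(m, d)) : 0 <= RIC k A.
Proof.
rewrite /RIC; set E := (X in inf X).
have [E0|/set0P/negP/negPn/eqP ->] := pselect (E !=set0)%classic; last first.
  by rewrite inf0.
by apply: lb_le_inf => // x [].
Qed.

(** Every admissible constant bounds [(|v|^2 - |A v|^2) / |v|^2] from above, hence so does their
    infimum; its attainment is never invoked. *)
Lemma RIC_contraction {R : realType} {m d : nat} k (A : 'M[R]_(m, d)) :
  (forall v, l2norm (A *m v) <= l2norm v) ->
  forall v, sparse k v ->
    dot v v - dot (A *m v) (A *m v) <= RIC k A * dot v v.
Proof.
move=> Ale v vk; rewrite -!l2norm_sqr.
have Ale2 (u : 'cV_d) : l2norm (A *m u) ^+ 2 <= l2norm u ^+ 2.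
  by rewrite ler_pXn2r // nnegrE l2norm_ge0.
have [v0|v0] := eqVneq (l2norm v) 0.
  rewrite v0 expr0n /= mulr0 sub0r oppr_le0; exact: sqr_ge0.
have v2 : 0 < l2norm v ^+ 2 by rewrite exprn_even_gt0.
rewrite -ler_pdivrMr //; apply: lb_le_inf.
  (* A contraction admits the constant 1, so the infimum is over a nonempty set. *)
  exists 1; split => // u _; rewrite subrr mul0r sqr_ge0; split => //.
  have := Ale2 u; have := sqr_ge0 (l2norm u); lra.
move=> delta [_ /(_ v vk)[lo _]]; rewrite ler_pdivrMr //; lra.
Qed.

(** * Quadratic form bounds for the Gram matrix *)

(* This is [N ^+ 2 <= 4^-1 N] for a symmetric matrix with spectrum in
   [0, 1/4]; expand [0 <= <z, N z>] at [z = u - 4 N u]. *)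
Lemma psd_quarter_sqr {R : realType} {n : nat} (N : 'M[R]_n) :
  N^T = N -> (forall z, 0 <= dot z (N *m z)) ->
  (forall z, 4 * dot z (N *m z) <= dot z z) ->
  forall u, 4 * dot (N *m u) (N *m u) <= dot u (N *m u).
Proof.
move=> Nsym N0 N4 u.
have := N0 (u - 4 *: (N *m u)); have := N4 (N *m u).
have Nadj v w : dot (N *m v) w = dot v (N *m w) by rewrite dot_trmx Nsym.
rewrite mulmxBr -scalemxAr !dotE (Nadj u (N *m (N *m u))) -(Nadj u (N *m u)).
rewrite -(Nadj u (N *m (N *m u))); lra.
Qed.

Lemma dot_gram {R : realType} {m d : nat} (A : 'M[R]_(m, d)) u v :
  dot u (A^T *m A *m v) = dot (A *m u) (A *m v).
Proof. by rewrite dot_trmx mulmxA. Qed.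

(** With [G = A^T A], the left side is [|u|^2 - 2 |A u|^2 + |G u|^2], and [|G u| <= |A u|] because
    [A^T] is a contraction. *)
Lemma gram_residual_sqr {R : realType} {m d : nat} (A : 'M[R]_(m, d)) u :
  (forall v, l2norm (A *m v) <= l2norm v) ->
  dot (u - A^T *m A *m u) (u - A^T *m A *m u)
    <= dot u u - dot (A *m u) (A *m u).
Proof.
move=> Ale; have := trmx_contraction A Ale (A *m u); rewrite mulmxA => Gle.
have : dot (A^T *m A *m u) (A^T *m A *m u) <= dot (A *m u) (A *m u).
  by rewrite -!l2norm_sqr ler_pXn2r // nnegrE l2norm_ge0.
by rewrite dotB_sqr (dot_gram _ u); lra.
Qed.

(** Spectrally, [4 (t (1 - t))^2 <= t (1 - t) <= 1 - t] for [t] in [0, 1]. *)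
Lemma gram_half_residual_sqr {R : realType} {m d : nat} (A : 'M[R]_(m, d)) u :
  (forall v, l2norm (A *m v) <= l2norm v) ->
  4 * dot (A^T *m A *m (u - A^T *m A *m u)) (A^T *m A *m (u - A^T *m A *m u))
    <= dot u u - dot (A *m u) (A *m u).
Proof.
move=> Ale; set G := A^T *m A; pose N := G - G *m G.
have Gsym : G^T = G by rewrite trmx_mul trmxK.
have NE v : N *m v = G *m (v - G *m v) by rewrite mulmxBl -(mulmxA G) mulmxBr.
have dotN v : dot v (N *m v) = dot (A *m v) (A *m v) - dot (G *m v) (G *m v).
  by rewrite NE mulmxBr !dotE (dot_gram _ v v) [in RHS](dot_trmx G) Gsym.
rewrite -NE; apply: (@le_trans _ _ (dot u (N *m u))).
  apply: psd_quarter_sqr => [|z|z].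
  - by rewrite linearB /= (trmx_mul G G) Gsym.
  - rewrite dotN subr_ge0 -!l2norm_sqr ler_pXn2r ?nnegrE ?l2norm_ge0 //.
    by rewrite /G -mulmxA trmx_contraction.
  (* The form of [t (1 - t) <= 1/4] is [0 <= |z - 2 G z|^2]. *)
  - rewrite dotN; have := dot_ge0 (z - 2 *: (G *m z)).
    by rewrite dotB_sqr !dotZl !dotZr (dot_gram _ z); lra.
(* [<u, N u> <= |u|^2 - |A u|^2]: the two sides differ by [|u - G u|^2]. *)
have := gram_residual_sqr A u Ale; rewrite -/G dotN.
have := dot_ge0 (u - G *m u).
by rewrite dotB_sqr (dot_gram _ u); lra.
Qed.

(** * Gradient of the cost and the look-ahead objective *)

Lemma partial_cost {R : realType} {m d : nat} (A : 'M[R]_(m, d)) y i z :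
  partial (cost A y) i z = - 2 * (A^T *m (y - A *m z)) i 0.
Proof.
set b := A^T *m (y - A *m z).
pose c := dot (A *m delta_mx i 0) (A *m delta_mx i 0).
have dot_delta (w : 'cV[R]_d) : dot (delta_mx i 0) w = w i 0.
  rewrite /dot (bigD1 i) //= mxE !eqxx mul1r big1 ?addr0 // => j ji.
  by rewrite mxE (negbTE ji) mul0r.
(* The cost is quadratic, so its difference quotient is affine in [h]. *)
have costE h : cost A y (h *: delta_mx i 0 + z) - cost A y z
             = h * (- 2 * b i 0 + h * c).
  rewrite /cost !l2norm_sqr mulmxDr -scalemxAr (addrC (h *: _)) opprD addrA.
  by rewrite dotB_sqr !dotZl !dotZr -/c dotC dot_trmx dot_delta -/b; ring.
have lim_quot : ((fun h : R => (- 2 * b i 0 + h * c)%R) @ 0%R^'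
    --> (- 2 * b i 0 + 0 * c)%R)%classic.
  apply: cvgD; first exact: cvg_cst.
  apply: cvgM; last exact: cvg_cst.
  exact: nbhs_dnbhs.
rewrite mul0r addr0 in lim_quot.
rewrite /partial /derive; apply: cvg_lim => //.
apply: cvg_trans lim_quot; apply: near_eq_cvg; near=> h.
rewrite costE /= /GRing.scale /= mulKf //.
by near: h; exact: nbhs_dnbhs_neq.
Unshelve. all: by end_near.
Qed.

Lemma lookahead_objE {R : realType} {m d : nat} (A : 'M[R]_(m, d)) y eta z x :
  lookahead_obj A y eta z x =
    cost A y z + (l2norm (x - z) ^+ 2
                  - 4 * eta * dot (x - z) (A^T *m (y - A *m z))).
Proof.
rewrite /lookahead_obj l2norm_sqr mulr_sumr -sumrB; congr (_ + _).
by apply: eq_bigr => i _; rewrite partial_cost !mxE; ring.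
Qed.

(** * Coordinate projections and the thresholding step *)

Lemma sparse_coord_projB {R : realType} {d k l : nat} (S T : {set 'I_d})
    (u v : 'cV[R]_d) :
  (#|S| <= k)%N -> (#|T| <= l)%N ->
  sparse (k + l) (coord_proj S u - coord_proj T v).
Proof.
move=> Sk Tl; apply: leq_trans (leq_add Sk Tl).
apply: leq_trans (leq_card_setU S T); apply: subset_leq_card.
apply/fintype.subsetP => i; rewrite !inE !mxE; apply: contraR.
by rewrite negb_or => /andP[/negbTE -> /negbTE ->]; rewrite subrr.
Qed.

(** Entrywise: on [S] the left side vanishes, off [S] both sides contribute [u i 0 ^+ 2]. *)
Lemma coord_proj_dist {R : realType} {d : nat} (S : {set 'I_d})
    (u v : 'cV[R]_d) :
  l2norm (coord_proj S u - u) <= l2norm (u - coord_proj S v).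
Proof.
rewrite ler_sqrt; last by apply: sumr_ge0 => i _; rewrite sqr_ge0.
apply: ler_sum => i _; rewrite !mxE; case: ifP => _.
  by rewrite subrr expr0n sqr_ge0.
by rewrite sub0r subr0 sqrrN.
Qed.

(** Minimality against [S] gives [|p|^2 - |q|^2 <= 4 eta <p - q, b> <= 4 eta (|p| + |q|) |b|];
    divide by [|p| + |q|]. *)
Lemma lookahead_threshold_dist {R : realType} {m d s : nat}
    (A : 'M[R]_(m, d)) y eta z w (S : {set 'I_d}) v :
  0 <= eta -> is_lookahead_threshold A y s eta z w -> #|S| = s ->
  l2norm (w - z) <= l2norm (z - coord_proj S v)
                    + 4 * eta * l2norm (A^T *m (y - A *m z)).
Proof.
move=> eta0 [T [_ wmin ->]] /wmin; rewrite !lookahead_objE lerD2l.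
set p := _ - z; set q := coord_proj S z - z; set b := A^T *m _ => pq.
have qle : l2norm q <= l2norm (z - coord_proj S v) by exact: coord_proj_dist.
have pqb : dot (p - q) b <= (l2norm p + l2norm q) * l2norm b.
  apply: (le_trans (dot_le_l2norm _ _)).
  by rewrite ler_wpM2r ?l2norm_ge0 ?ler_l2normB.
have p0 := l2norm_ge0 p; have q0 := l2norm_ge0 q; have b0 := l2norm_ge0 b.
apply: (@le_trans _ _ (l2norm q + 4 * eta * l2norm b)); last by rewrite lerD2r.
(* If [|p| <= |q|] the bound is immediate; otherwise the divisor is positive. *)
have [pq0|pq0] := leP (l2norm p) (l2norm q).
  by apply: (le_trans pq0); rewrite lerDl !mulr_ge0.
have sum_gt0 : 0 < l2norm p + l2norm q by lra.
rewrite -(ler_pM2l sum_gt0).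
have := ler_wpM2l (mulr_ge0 (ler0n R 4) eta0) pqb.
move: pq; rewrite !dotE; lra.
Qed.

(** * Error contraction along the iteration *)

Theorem theorem3p8 (R : realType) (s d m : nat)
    (s_gt0 : (0 < s)%N) (s_le_d : (s <= d)%N) (m_gt0 : (0 < m)%N)
    (A : 'M[R]_(m, d)) (A_norm : op_norm A = 1)
    (xstar : 'cV[R]_d) (e y : 'cV[R]_m) (y_def : y = A *m xstar + e)
    (eta : R) (eta_ge0 : 0 <= eta) (eta_le1 : eta <= 1)
    (x a : nat -> 'cV[R]_d) (x_ILAT : is_ILAT A y s eta x a)
    (Hsx : 'cV[R]_d) (HsxP : is_hard_threshold s xstar Hsx)
    (etilde : 'cV[R]_m) (etilde_def : etilde = y - A *m Hsx)
    (RIC_lt : RIC (2 * s)%N A < 1 / (2 + 2 * eta) ^+ 2)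
    (rho : R) (rho_def : rho = (2 + 2 * eta) * Num.sqrt (RIC (2 * s)%N A)) :
  rho < 1 /\
  forall t : nat, (1 <= t)%N ->
    l2norm (Hsx - x t) <=
      rho * l2norm (Hsx - x t.-1) + (2 + 8 * eta) * l2norm etilde.
Proof.
have Ale := op_norm1_contraction A A_norm.
have ATle := trmx_contraction A Ale.
set del := RIC _ A in RIC_lt rho_def; have del0 : 0 <= del := RIC_ge0 _ _.
have eta2 : 0 < 2 + 2 * eta by lra.
split.
  rewrite rho_def mulrC -ltr_pdivlMr // -(ger0_norm (ltW (divr_gt0 ltr01 eta2))).
  by rewrite -sqrtr_sqr ltr_sqrt ?exprn_gt0 ?divr_gt0 // expr_div_n expr1n.
move=> t t_gt0; have [x0 xS] := x_ILAT.
have [atE xt] := xS t t_gt0.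
have [S [cS _ HsxE]] := HsxP.
(* Only an upper bound on the size of [T]: the start [x 0 = 0] takes the empty set, later iterates
   their selected support. *)
have [T [cT xT]] : exists T : {set 'I_d},
    (#|T| <= s)%N /\ x t.-1 = coord_proj T (x t.-1).
  case: t t_gt0 {atE xt} => // -[|t] _ /=.
    exists finset.set0; rewrite cards0 x0; split => //.
    by apply/matrixP => i j; rewrite !mxE if_same.
  have [_ [T [cT _ xT]]] := xS t.+1 isT; exists T; rewrite cT; split => //.
  by rewrite xT; apply/matrixP => i j; rewrite !mxE; case: ifP.
set v := Hsx - x t.-1.
have v_sparse : sparse (2 * s) v.
  by rewrite /v HsxE xT mul2n -addnn sparse_coord_projB ?cS.
have vRIC := RIC_contraction _ A Ale v v_sparse; rewrite -/del in vRIC.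
pose G := A^T *m A; pose u := v - G *m v.
have yE : y = etilde + A *m Hsx by rewrite etilde_def subrK.
have atH : a t - Hsx = A^T *m etilde - u.
  rewrite atE yE -(addrA etilde) -mulmxBr mulmxDr mulmxA -/v -/G /u /v.
  apply/matrixP => i j; rewrite !mxE; ring.
have bE : A^T *m (y - A *m a t) = A^T *m etilde - G *m (A^T *m etilde) + G *m u.
  have -> : y - A *m a t = etilde - A *m (A^T *m etilde) + A *m u.
    rewrite yE -addrA -mulmxBr -(opprB (a t)) atH mulmxN mulmxBr opprB.
    by rewrite addrCA addrC.
  by rewrite mulmxDr mulmxBr /G -!mulmxA.
have u_le : l2norm u <= Num.sqrt del * l2norm v.
  apply: l2norm_le; first by rewrite mulr_ge0 ?sqrtr_ge0 ?l2norm_ge0.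
  rewrite exprMn sqr_sqrtr // l2norm_sqr.
  exact: le_trans (gram_residual_sqr A v Ale) vRIC.
(* The factor 1/2 is the square root of the 4 in [gram_half_residual_sqr], inverted. *)
have Gu_le : l2norm (G *m u) <= 2^-1 * (Num.sqrt del * l2norm v).
  apply: l2norm_le; first by rewrite !mulr_ge0 ?invr_ge0 ?sqrtr_ge0 ?l2norm_ge0.
  rewrite !exprMn sqr_sqrtr // l2norm_sqr.
  have := gram_half_residual_sqr A v Ale; rewrite -/G -/u; lra.
have e_le := ATle etilde.
have Me_le : l2norm (A^T *m etilde - G *m (A^T *m etilde)) <= l2norm etilde.
  apply: le_trans e_le; apply: l2norm_le; first exact: l2norm_ge0.
  apply: le_trans (gram_residual_sqr A _ Ale) _.
  by rewrite l2norm_sqr lerBlDr lerDl dot_ge0.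
have r_le : l2norm (a t - Hsx) <= Num.sqrt del * l2norm v + l2norm etilde.
  by rewrite atH (le_trans (ler_l2normB _ _)) // addrC lerD.
have b_le : l2norm (A^T *m (y - A *m a t))
    <= l2norm etilde + 2^-1 * (Num.sqrt del * l2norm v).
  by rewrite bE (le_trans (ler_l2normD _ _)) // lerD.
have xt_le :=
  lookahead_threshold_dist A y eta (a t) (x t) S xstar eta_ge0 xt cS.
rewrite -HsxE in xt_le.
have -> : Hsx - x t = - (a t - Hsx) - (x t - a t).
  by apply/matrixP => i j; rewrite !mxE; ring.
apply: (le_trans (ler_l2normB _ _)); rewrite l2normN rho_def -/v.
(* The sum [2 |a^t - h| + 4 eta |b|] is at most [(2 + 2 eta) sqrt del |v| + (2 + 4 eta) |etilde|];
   the next fact, [0 <= eta |etilde|], relaxes [4 eta] to [8 eta]. *)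
have := ler_wpM2l (mulr_ge0 (ler0n R 4) eta_ge0) b_le.
have := mulr_ge0 eta_ge0 (l2norm_ge0 etilde).
lra.
Qed.
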